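(* Let $q=p^m$ with $p$ prime, and let $n+1\ge3$ be a prime different from $p$ with $n+1\nmid q^2-1$. Put $\alpha_i=\zeta_{n+1}^i+\zeta_{n+1}^{-i}$ and $\beta_i=\zeta_{n+1}^i-\zeta_{n+1}^{-i}$ for $i\in\{1,\dots,n/2\}$, where $\zeta_{n+1}$ is a primitive $(n+1)$-th root of unity. The polynomial $g(x)=D_{n+1}(x+e,a)-D_{n+1}(e,a)$, with $a,e\in\mathbb F_q$, $a\neq0$, and $D'_{n+1}(e,a)\neq0$, is a good exceptional polynomial over $\mathbb F_q$ if and only if one of the following cases occurs: (i) $p\neq2$, $n/2$ is even and the order of $q$ modulo $n+1$ is $n$; (ii) $p\neq2$, $n/2$ is odd, and either $e^2-4a$ is $0$ or a non-square in $\mathbb F_q$ and the order of $q$ modulo $n+1$ is $n/2$, or $e^2-4a$ is a square in $\mathbb F_q$ and the order of $q$ modulo $n+1$ is $n$; (iii) $p=2$, the order of $q$ modulo $n+1$ is $n$ or $n/2$, and $T_{q^{n/2}}(\delta_1)=1$, where $\delta_i=\frac1{\alpha_i}+\frac a{e^2}$. In cases (i) and (ii), the roots of $h_g(-x)$ are $$b=-\frac12\cdot\left(e(\alpha_i-2)\pm\sqrt{\beta_i^2(e^2-4a)}\right).$$ In case (iii), let $\varepsilon\in\mathbb F_{q^n}$ with $T_{q^{n/2}}(\varepsilon)=1$. Then the roots of $h_g(-x)$ are $$b=\varepsilon\delta_i^{2}+(\varepsilon+\varepsilon^2)\delta_i^{4}+\dots+(\varepsilon+\varepsilon^2+\dots+\varepsilon^{q^n/4})\delta_i^{q^n/2}\quad\text{and}\quad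 b+1.$$
   Context: $D_{n+1}(x,a)=\sum_{k=0}^{n/2}\frac{n+1}{n+1-k}\binom{n+1-k}{k}(-a)^kx^{n+1-2k}$ is the Dickson polynomial of degree $n+1$, and $D'_{n+1}(x,a)$ its derivative with respect to $x$. A polynomial $f\in\mathbb F_q[x]$ is exceptional over $\mathbb F_q$ if it is a permutation polynomial of $\mathbb F_{q^s}$ (induces a bijection of $\mathbb F_{q^s}$) for infinitely many $s$. An exceptional polynomial $g\in\mathbb F_q[x]$ with $g(0)=0$ and $g'(0)\neq0$ is called good if the roots of $\frac{g(-x)}{-x}$ form a unique orbit under the Frobenius map $x\mapsto x^q$. Here $h_g(x)=\frac{g(x)-g(0)}{x}$. For $p=2$, $T_{q^{n/2}}$ denotes the absolute trace map $\mathbb F_{q^{n/2}}\to\mathbb F_2$, $x\mapsto x+x^2+x^4+\dots+x^{(q^{n/2})/2}$. The order of $q$ modulo $n+1$ is its multiplicative order. In the formulas for the roots, $i$ ranges over $\{1,\dots,n/2\}$.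
   Formalization: For p=2 the printed claim fails and is corrected: e≠0 is assumed so that δ_i is defined; ε satisfies T_{q^n}(ε)=1 instead of T_{q^{n/2}}(ε)=1; and the roots of h_g(-x) are α_i·e·b and α_i·e·(b+1) instead of b and b+1. *)

(* Defs.v *)
From HB Require Import structures.
From mathcomp Require Import all_boot all_order all_algebra all_field.

Set Implicit Arguments.
Unset Strict Implicit.
Unset Printing Implicit Defensive.

Import GRing.Theory.
Local Open Scope ring_scope.

(* D_N(x, a) for N > 0.  N / (N - k) * 'C(N - k, k) is an integer, so the
   division %/ in nat is exact; its image in the field is then taken. *)
Definition dickson (R : nzRingType) (N : nat) (a : R) : {poly R} :=
  \sum_(k < N./2.+1)
    (((N * 'C(N - k, k)) %/ (N - k))%:R * (- a) ^+ k) *: 'X^(N - k.*2).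

Definition shifted_dickson (R : nzRingType) (N : nat) (a e : R) : {poly R} :=
  dickson N a \Po ('X + e%:P) - ((dickson N a).[e])%:P.

Definition h_poly (F : fieldType) (g : {poly F}) : {poly F} :=
  (g - (g.[0])%:P) %/ 'X.

(* With q = #|F|, the degree-s extension of F is F_{q^s}, which is unique up
   to isomorphism over F. *)
Definition permutes_ext (F : finFieldType) (f : {poly F}) (s : nat) : Prop :=
  exists L : fieldExtType F,
    \dim {: L} = s /\ bijective (fun x : L => (map_poly (in_alg L) f).[x]).

Definition exceptional (F : finFieldType) (f : {poly F}) : Prop :=
  forall N : nat, exists s : nat, (N < s)%N /\ permutes_ext f s.

(* K is any algebraically closed extension of F, via iota; roots of
   polynomials over F all lie in the algebraic closure of F inside K.  The
   roots are considered as a set, without multiplicity. *)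
Definition good (F : finFieldType) (K : closedFieldType)
    (iota : {rmorphism F -> K}) (g : {poly F}) : Prop :=
  [/\ exceptional g, g.[0] = 0, (g^`()).[0] != 0 &
    exists b : K, forall x : K,
      root (map_poly iota ((g \Po (- 'X)) %/ (- 'X))) x <->
      exists k : nat, x = b ^+ (#|F| ^ k)].

(* d is the multiplicative order of q modulo N (for N > 1). *)
Definition order_mod (q N d : nat) : Prop :=
  d.-primitive_root (q%:R : 'Z_N).

Definition is_square (R : nzRingType) (x : R) : Prop :=
  exists y : R, y ^+ 2 = x.

(* Membership in F_{q^s}, as a subfield of an algebraically closed field of
   the same characteristic. *)
Definition in_Fq (K : nzRingType) (q s : nat) (x : K) : Prop :=
  x ^+ (q ^ s) = x.

(* For Q a power of 2: x + x^2 + x^4 + ... + x^(Q/2). *)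
Definition abs_trace2 (K : nzRingType) (Q : nat) (x : K) : K :=
  \sum_(j < logn 2 Q) x ^+ (2 ^ j).

(* For Q a power of 2:
   eps d^2 + (eps + eps^2) d^4 + ... + (eps + ... + eps^(Q/4)) d^(Q/2). *)
Definition as_root (K : nzRingType) (Q : nat) (eps d : K) : K :=
  \sum_(1 <= j < logn 2 Q) (\sum_(k < j) eps ^+ (2 ^ k)) * d ^+ (2 ^ j).

Definition alpha (K : fieldType) (zeta : K) (i : nat) : K :=
  zeta ^+ i + zeta ^- i.

Definition beta (K : fieldType) (zeta : K) (i : nat) : K :=
  zeta ^+ i - zeta ^- i.

(* Meaningful for e != 0 and alpha zeta i != 0 only, since 0^-1 = 0. *)
Definition delta (K : fieldType) (zeta a e : K) (i : nat) : K :=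
  (alpha zeta i)^-1 + a / e ^+ 2.

Definition case_i (p q n : nat) : Prop :=
  [/\ p <> 2%N, ~~ odd n./2 & order_mod q n.+1 n].

Definition case_ii (F : finFieldType) (p q n : nat) (a e : F) : Prop :=
  let D := e ^+ 2 - 4%:R * a in
  [/\ p <> 2%N, odd n./2 &
      (D = 0 \/ ~ is_square D) /\ order_mod q n.+1 n./2 \/
      is_square D /\ order_mod q n.+1 n].

Definition case_iii (K : fieldType) (p q n : nat) (zeta a e : K) : Prop :=
  [/\ p = 2%N, order_mod q n.+1 n \/ order_mod q n.+1 n./2 &
      abs_trace2 (q ^ n./2) (delta zeta a e 1) = 1].

(* Main.v *)
(* Write e = u + v and a = u v over the algebraic closure.  As
   D_N(u + v, u v) = u^N + v^N with N = n + 1, the solutions of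
   D_N(y, a) = D_N(e, a) are the points y_z = z u + z^-1 v with z^N = 1, and
   D_N'(e, a) != 0 means that y_z = y_1 only for z = 1.  So the roots of
   h_g(-x) are the e - y_z with z != 1.
   The Frobenius map fixes or swaps u and v, hence sends y_z to y_(z^c) with
   c = q or c = -q.  If u != v the y_z are distinct and form one orbit iff c has
   order n modulo N; if u = v then y_z = y_(1/z), and they form one orbit iff
   the powers of q cover the units modulo N up to sign.  For odd p the two
   cases are told apart by e^2 - 4 a = (u - v)^2.  For p = 2 one has
   delta_i = P^2 + P with P = z / (1 + z) + u / e and z = zeta^i, so the trace of
   delta_i over F_(q^s) is the difference of P^(q^s) and P.
   Every such g is exceptional: N does not divide q^(2s) - 1 for s = 1 modulo n,
   and then z u is fixed by the 2s-th power of Frobenius only for z = 1. *)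
Require Import Defs.
From HB Require Import structures.
From mathcomp Require Import all_boot all_order all_algebra all_solvable all_field.
From mathcomp Require Import ring zify.

Set Implicit Arguments.
Unset Strict Implicit.
Unset Printing Implicit Defensive.

Import GRing.Theory.
Local Open Scope ring_scope.

(** * Dickson polynomials *)

Definition dickson_coef (N k : nat) : nat := (N * 'C(N - k, k)) %/ (N - k).

(** Allows sums of these coefficients to run past [N./2], so that the three sums in the Dickson
    recursion can be compared term by term. *)
Lemma dickson_coef_small (N k : nat) : (N < k.*2)%N -> dickson_coef N k = 0%N.
Proof.
move=> lt_N_2k; rewrite /dickson_coef bin_small ?muln0 ?div0n //.
have [lekN|/ltnW leNk] := leqP k N; first by rewrite ltn_subLR // addnn.
move: lt_N_2k; rewrite (eqP leNk); by case: k {leNk}.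
Qed.

Lemma dickson_coef0 (N : nat) : (0 < N)%N -> dickson_coef N 0 = 1%N.
Proof. by move=> N0; rewrite /dickson_coef subn0 bin0 muln1 divnn N0. Qed.

(** Put M = N - (k+1). From N = M + (k+1) and (k+1) C(M, k+1) = M C(M-1, k), the number M divides
    the product, so the truncated division is exact. *)
Lemma dickson_coefS (N k : nat) : (k.+1 < N)%N ->
  dickson_coef N k.+1 = ('C(N - k.+1, k.+1) + 'C(N - k.+2, k))%N.
Proof.
move=> ltkN; rewrite /dickson_coef; set M := (N - k.+1)%N.
have M0 : (0 < M)%N by rewrite subn_gt0.
have -> : (N - k.+2 = M.-1)%N by rewrite subnS.
have -> : N = (M + k.+1)%N by rewrite subnK // ltnW.
by rewrite mulnDl -[in X in (_ + X)%N](mul_bin_diag M k) -mulnDr mulKn.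
Qed.

(** In the form of [dickson_coefS] this is Pascal's rule for each of the two binomials; [k = 0] is
    apart because [dickson_coef N 0] is not of that form. *)
Lemma dickson_coef_rec (N k : nat) : (0 < N)%N ->
  dickson_coef N.+2 k.+1 = (dickson_coef N.+1 k.+1 + dickson_coef N k)%N.
Proof.
move=> N0; have [ltN|] := ltnP N.+2 k.+1.*2.
  by by rewrite !dickson_coef_small //; lia.
rewrite doubleS !ltnS => le2k.
have lekN : (k <= N)%N by lia.
rewrite dickson_coefS; last lia.
case: k le2k lekN => [|k] le2k lekN.
  rewrite dickson_coef0 // dickson_coefS //.
  by rewrite !bin1 !bin0; lia.
have [ltkN|leNk] := ltnP k.+1 N; last by lia.
rewrite dickson_coefS; last by lia.
rewrite dickson_coefS // !subSS.
have -> : (N - k = (N - k.+1).+1)%N by lia.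
have [lt2|ge2] := ltnP k.+1.*2 N.
  have -> : (N - k.+1 = (N - k.+2).+1)%N by lia.
  by rewrite !binS; lia.
have -> : (N - k.+1 = k.+1)%N by lia.
have -> : (N - k.+2 = k)%N by lia.
by rewrite !binn !bin_small //; lia.
Qed.

Lemma dicksonE (R : nzRingType) (N B : nat) (a : R) : (N./2 < B)%N ->
  dickson N a = \sum_(k < B) ((dickson_coef N k)%:R * (- a) ^+ k) *: 'X^(N - k.*2).
Proof.
move=> ltNB; rewrite /dickson -!(big_mkord xpredT (fun k =>
  ((dickson_coef N k)%:R * (- a) ^+ k) *: 'X^(N - k.*2))).
rewrite [RHS](@big_cat_nat _ _ _ N./2.+1) //= [X in _ = _ + X]big1_seq ?addr0 //.
move=> k; rewrite mem_index_iota => /andP[_ /andP[ltNk _]].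
by rewrite dickson_coef_small ?mul0r ?scale0r //; lia.
Qed.

Lemma dickson1 (R : nzRingType) (a : R) : dickson 1 a = 'X.
Proof. by rewrite /dickson big_ord1 /= expr0 mulr1 scale1r expr1. Qed.

Lemma dickson2 (R : nzRingType) (a : R) : dickson 2 a = 'X^2 - (a *+ 2)%:P.
Proof.
rewrite /dickson big_ord_recl big_ord1 /= expr0 mulr1 scale1r expr0 alg_polyC.
by rewrite expr1 mulrN polyCN mulr_natl.
Qed.

(* Not valid for [N = 0]: [dickson 0 a] is [0], whereas D_0 is usually 2. *)
Lemma dickson_rec (R : comNzRingType) (N : nat) (a : R) : (0 < N)%N ->
  dickson N.+2 a = 'X * dickson N.+1 a - a *: dickson N a.
Proof.
move=> N0; rewrite (@dicksonE _ N.+2 N.+3) ?(@dicksonE _ N.+1 N.+3)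
  ?(@dicksonE _ N N.+2); try lia.
rewrite 2![\sum_(k < N.+3) _]big_ord_recl /= !dickson_coef0 // expr0.
rewrite !mul1r !scale1r !subn0.
rewrite mulrDr -exprS -addrA; congr (_ + _).
rewrite mulr_sumr scaler_sumr -sumrB; apply: eq_bigr => k _ /=.
rewrite /bump /= add1n doubleS !subSS dickson_coef_rec // natrD mulrDl scalerDl.
congr (_ + _); last first.
  by rewrite exprS scalerA -scaleNr; congr (_ *: _); ring.
have [lt|le] := ltnP k.*2 N; last first.
  by rewrite dickson_coef_small ?mul0r ?scale0r ?mulr0 //; lia.
by rewrite -scalerAr -exprS; congr (_ *: 'X^_); lia.
Qed.

(** Based at 1 and 2, since [dickson_rec] starts only there. *)
Lemma dickson_ind (P : nat -> Prop) :
  P 1%N -> P 2%N -> (forall N, (0 < N)%N -> P N -> P N.+1 -> P N.+2) ->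
  forall N, (0 < N)%N -> P N.
Proof.
move=> P1 P2 PS N N0.
suff [] : P N /\ P N.+1 by [].
case: N N0 => // N _; elim: N => [//|N [PN PN1]]; split=> //; exact: PS.
Qed.

Lemma horner_dickson (R : comNzRingType) (N : nat) (u v : R) : (0 < N)%N ->
  (dickson N (u * v)).[u + v] = u ^+ N + v ^+ N.
Proof.
move: N; apply: dickson_ind => [||N N0 PN PN1].
- by rewrite dickson1 hornerX.
- by rewrite dickson2 !hornerE; ring.
- by rewrite dickson_rec // !hornerE PN PN1 !exprS; ring.
Qed.

(** Formally, this is y times the derivative in y of D_N(y + a/y, a) = y^N + (a/y)^N. The recursion
    yields it without division, so also for u = v. *)
Lemma horner_deriv_dickson (R : comNzRingType) (N : nat) (u v : R) : (0 < N)%N ->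
  (u - v) * (dickson N (u * v))^`().[u + v] = N%:R * (u ^+ N - v ^+ N).
Proof.
move: N; apply: dickson_ind => [||N N0 PN PN1].
- by rewrite dickson1 derivX hornerE; ring.
- by rewrite dickson2 derivB derivXn derivC /= expr1 subr0 hornerMn hornerX; ring.
- have -> : (u - v) * (dickson N.+2 (u * v))^`().[u + v] =
    (u - v) * (dickson N.+1 (u * v)).[u + v]
    + (u + v) * ((u - v) * (dickson N.+1 (u * v))^`().[u + v])
    - u * v * ((u - v) * (dickson N (u * v))^`().[u + v]).
    rewrite dickson_rec // derivB derivM derivX derivZ.
    by rewrite !(hornerD, hornerN, hornerM, hornerX, hornerZ, hornerC); ring.
  rewrite PN PN1 horner_dickson // -!natr1 !exprS; ring.
Qed.

Lemma map_dickson (R S : nzRingType) (f : {rmorphism R -> S}) (N : nat) (a : R) :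
  map_poly f (dickson N a) = dickson N (f a).
Proof.
rewrite /dickson rmorph_sum; apply: eq_bigr => k _ /=.
by rewrite map_polyZ map_polyXn rmorphM rmorph_nat rmorphXn rmorphN.
Qed.

(** * Multiplicative orders in a finite field *)

Lemma primitive_root_expr_half (R : idomainType) (n : nat) (c : R) : ~~ odd n ->
  n.-primitive_root c -> c ^+ n./2 = -1.
Proof.
move=> n_even cn; have n_gt0 := prim_order_gt0 cn.
have : (c ^+ n./2) ^+ 2 == 1.
  by rewrite -exprM muln2 even_halfK // (prim_expr_order cn).
rewrite sqrf_eq1 => /orP[|/eqP //].
by rewrite -(prim_order_dvd cn) => /dvdn_leq; lia.
Qed.

Section FiniteFieldOrders.

Variables (E : finFieldType) (n : nat).
Hypotheses (card_E : #|E| = n.+1) (n_gt0 : (0 < n)%N).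

Lemma expf_card_pred (c : E) : c != 0 -> c ^+ n = 1.
Proof.
move=> c0; apply: (mulfI c0).
by rewrite -exprS -card_E expf_card mulr1.
Qed.

Lemma finField_exponent (L : nat) : (0 < L)%N ->
  (forall z : E, z != 0 -> z ^+ L = 1) -> (n <= L)%N.
Proof.
move=> L0 zL; have <- : size (enum (predC1 (0 : E))) = n.
  by rewrite -cardE cardC1 card_E.
apply: max_unity_roots => //; last exact: enum_uniq.
by apply/allP => z; rewrite mem_enum => z0; apply/unity_rootP/zL.
Qed.

Lemma finField_order (c : E) : c != 0 ->
  exists2 d, d.-primitive_root c & (d %| n)%N.
Proof.
by move=> /expf_card_pred /(prim_order_exists n_gt0) [d cd dn]; exists d.
Qed.

(** If all units are powers of c, then the order d of c annihilates all n of them, while X^d - 1 has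
    at most d roots. *)
Lemma primitive_root_powers (c : E) : c != 0 ->
  (forall z, z != 0 -> exists k, z = c ^+ k) <-> n.-primitive_root c.
Proof.
move=> c0; split=> [zc|cn z z0]; last first.
  by have /(prim_rootP cn) [k ->] := expf_card_pred z0; exists k.
have [d cd dn] := finField_order c0.
have nd : (n <= d)%N.
  apply: finField_exponent (prim_order_gt0 cd) _ => z /zc [k ->].
  by rewrite exprAC (prim_expr_order cd) expr1n.
by have <- : d = n by apply/eqP; rewrite eqn_leq nd dvdn_leq.
Qed.

Hypotheses (n_even : ~~ odd n) (two_neq0 : 2%:R != 0 :> E).

Lemma oppf_neq1 : -1 != 1 :> E.
Proof. by rewrite eq_sym -subr_eq0 opprK. Qed.

(** Negation preserves an order divisible by 4 and exchanges the orders d and 2d for odd d. *)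
Lemma primitive_root_oppf (c : E) : c != 0 ->
  n.-primitive_root (- c) <->
  ~~ odd n./2 /\ n.-primitive_root c \/ odd n./2 /\ n./2.-primitive_root c.
Proof.
have fwd (b : E) : b != 0 -> n.-primitive_root (- b) ->
    ~~ odd n./2 /\ n.-primitive_root b \/ odd n./2 /\ n./2.-primitive_root b.
  move=> b0 bn; have [d bd dn] := finField_order b0.
  have [od|ed] := boolP (odd d).
    right; have nd : (n %| d.*2)%N.
      rewrite (prim_order_dvd bn) -mul2n exprM sqrrN -exprM mulnC exprM.
      by rewrite (prim_expr_order bd) expr1n.
    have dE : d = n./2.
      case/dvdnP: dn => k nE; have d0 := prim_order_gt0 bd.
      have : (k <= 2)%N.
        by rewrite -(leq_pmul2r d0) -nE mul2n dvdn_leq ?double_gt0.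
      by case: k nE => [|[|[|k]]] //; lia.
    by rewrite -dE.
  left; have dE : d = n.
    apply/eqP; rewrite eqn_dvd dn (prim_order_dvd bn) exprNn -signr_odd.
    by rewrite (negbTE ed) expr0 mul1r (prim_expr_order bd) eqxx.
  rewrite dE in bd; split=> //; apply/negP => o2.
  have : (- b) ^+ n./2 == 1.
    by rewrite exprNn -signr_odd o2 primitive_root_expr_half // mulrNN mulr1 eqxx.
  by rewrite -(prim_order_dvd bn) => /dvdn_leq; lia.
move=> c0; split; first exact: fwd.
have Nc0 : - c != 0 by rewrite oppr_eq0.
case=> [[e2 cn]|[o2 cn]].
  (* Negation is an involution, so the direction already proved, taken at [- c], settles this
     case. *)
  by have [|[_ //]|[]] := fwd (- c) Nc0; [rewrite opprK|rewrite (negbTE e2)].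
have [d cd dn] := finField_order Nc0.
suff <- : d = n by [].
have [od|ed] := boolP (odd d).
  have cdN : c ^+ d = -1.
    rewrite -[c]opprK exprNn -signr_odd od (prim_expr_order cd).
    by rewrite mulr1.
  have : (n./2 %| d * 2)%N.
    by rewrite (prim_order_dvd cn) exprM cdN sqrrN expr1n eqxx.
  rewrite Gauss_dvdl ?coprimen2 // (prim_order_dvd cn) cdN.
  by rewrite (negbTE oppf_neq1).
apply/eqP; rewrite eqn_dvd dn /= -(even_halfK n_even) -muln2.
rewrite Gauss_dvd ?coprimen2 // dvdn2 ed andbT (prim_order_dvd cn).
by rewrite -[c]opprK exprNn -signr_odd (negbTE ed) (prim_expr_order cd) mulr1 eqxx.
Qed.

Lemma primitive_root_signed_powers (c : E) : c != 0 ->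
  (forall z, z != 0 -> exists k, z = c ^+ k \/ z = - c ^+ k) <->
  n.-primitive_root c \/ odd n./2 /\ n./2.-primitive_root c.
Proof.
move=> c0; split=> [zc|]; last first.
  case=> [cn|o2] z z0.
    by have [k ->] := (primitive_root_powers c0).2 cn z z0; exists k; left.
  have Nc0 : - c != 0 by rewrite oppr_eq0.
  have cn : n.-primitive_root (- c) by apply/primitive_root_oppf => //; right.
  have [k ->] := (primitive_root_powers Nc0).2 cn z z0; exists k.
  rewrite exprNn -signr_odd; case: (odd k); rewrite ?expr1 ?expr0.
    by right; rewrite mulN1r.
  by left; rewrite mul1r.
have [d cd dn] := finField_order c0.
have d0 := prim_order_gt0 cd.
(* An exponent annihilating every c^k and every -c^k; it is doubled for odd d because (-1)^d = -1
   there. *)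
pose L := if odd d then (d * 2)%N else d.
have nL : (n <= L)%N.
  apply: finField_exponent => [|z /zc [k zE]].
    by rewrite /L; case: ifP; lia.
  have ckd : (c ^+ k) ^+ d = 1 by rewrite exprAC (prim_expr_order cd) expr1n.
  rewrite /L; case: ifP => [_|ed].
    by rewrite mulnC exprM; case: zE => ->; rewrite ?sqrrN exprAC ckd expr1n.
  by case: zE => -> //; rewrite exprNn -signr_odd ed mul1r.
case/dvdnP: dn => k nE; rewrite /L in nL; case: ifP nL => od nL.
  right; have k2 : k = 2%N.
    have : (k <= 2)%N by rewrite -(leq_pmul2r d0) -nE mulnC.
    by case: k nE => [|[|[|k]]] //; lia.
  by have <- : d = n./2 by lia.
left; suff <- : d = n by [].
have : (k <= 1)%N by rewrite -(leq_pmul2r d0) -nE mul1n.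
by case: k nE => [|[|k]] //; lia.
Qed.

End FiniteFieldOrders.

(** ['F_N] unfolds to ['Z_(pdiv N)], whence the detour through [pdiv N]. *)
Lemma order_mod_Fp (q N d : nat) : prime N ->
  order_mod q N d = d.-primitive_root (q%:R : 'F_N).
Proof.
move=> prN; have <- : order_mod q (pdiv N) d = d.-primitive_root (q%:R : 'F_N).
  by [].
by rewrite pdiv_id.
Qed.

(** * Frobenius and finite subextensions of a closed field *)

(** As n is invertible in K, X^n - 1 is separable and has n distinct roots, so one of them has order
    n. *)
Lemma closed_field_primitive_root (K : closedFieldType) (n : nat) :
  n%:R != 0 :> K -> exists z : K, n.-primitive_root z.
Proof.
move=> n0; have n_gt0 : (0 < n)%N by case: n n0; rewrite ?eqxx.
have [r Dr] := closed_field_poly_normal ('X^n - 1 : {poly K}).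
have mon : ('X^n - 1 : {poly K}) \is monic by apply: monicXnsubC.
rewrite (monicP mon) scale1r in Dr.
have /hasP[z _ zn] : has n.-primitive_root r.
  apply: has_prim_root => //.
  - by apply/allP => z zr; rewrite /root_of_unity Dr root_prod_XsubC.
  - by rewrite -separable_prod_XsubC -Dr cyclotomic.separable_Xn_sub_1.
  have := congr1 (size \o @polyseq K) Dr.
  by rewrite /= size_prod_XsubC size_XnsubC // => -[->].
by exists z.
Qed.

Lemma expr_fixed_iter (R : nzRingType) (x : R) (Q k : nat) :
  x ^+ Q = x -> x ^+ (Q ^ k) = x.
Proof. by move=> xQ; elim: k => // k IH; rewrite expnS exprM xQ. Qed.

Section Frobenius.

Variables (p m : nat) (F : finFieldType) (K : closedFieldType).
Variable iota : {rmorphism F -> K}.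
Hypotheses (p_prime : prime p) (card_F : #|F| = (p ^ m)%N).

Lemma pchar_closure : p \in [pchar K].
Proof. by rewrite (fmorph_pchar iota) (card_finPcharP card_F). Qed.

Lemma frobeniusD (s : nat) (x y : K) :
  (x + y) ^+ (#|F| ^ s) = x ^+ (#|F| ^ s) + y ^+ (#|F| ^ s).
Proof.
apply: exprDn_pchar; rewrite (eq_pnat _ (pcharf_eq pchar_closure)) card_F.
by rewrite !pnatX pnat_id.
Qed.

Lemma frobeniusN (s : nat) (x : K) : (- x) ^+ (#|F| ^ s) = - x ^+ (#|F| ^ s).
Proof.
apply/eqP; rewrite -addr_eq0 -frobeniusD addNr expr0n.
by rewrite expn_eq0 -leqn0 leqNgt ltnW ?finNzRing_gt1.
Qed.

Lemma frobeniusB (s : nat) (x y : K) :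
  (x - y) ^+ (#|F| ^ s) = x ^+ (#|F| ^ s) - y ^+ (#|F| ^ s).
Proof. by rewrite frobeniusD frobeniusN. Qed.

Lemma frobenius_iota (s : nat) (c : F) : iota c ^+ (#|F| ^ s) = iota c.
Proof. by apply: expr_fixed_iter; rewrite -rmorphXn expf_card. Qed.

Lemma frobenius_horner (s : nat) (f : {poly F}) (x : K) :
  (map_poly iota f).[x] ^+ (#|F| ^ s) = (map_poly iota f).[x ^+ (#|F| ^ s)].
Proof.
elim/poly_ind: f => [|f c IH].
  by rewrite rmorph0 !horner0 expr0n expn_eq0 -leqn0 leqNgt ltnW ?finNzRing_gt1.
rewrite rmorphD rmorphM /= map_polyX map_polyC !hornerE /=.
by rewrite frobeniusD exprMn IH frobenius_iota.
Qed.

(** X^q - X is the product of the X - c for c in F, so it has no further root in K. *)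
Lemma frobenius_fixed (x : K) : x ^+ #|F| = x -> exists c, x = iota c.
Proof.
move=> xq; have := congr1 (fun f => (map_poly iota f).[x]) (finField_genPoly F).
rewrite rmorphB rmorph_prod /= map_polyXn map_polyX !hornerE xq subrr.
move/esym/eqP; rewrite horner_prod => /prodf_eq0 [c _].
by rewrite map_polyXsubC hornerXsubC subr_eq0 => /eqP; exists c.
Qed.

Lemma natr_card (s : nat) : (0 < s)%N -> (#|F| ^ s)%:R = 0 :> K.
Proof.
move=> s0; apply/eqP; rewrite -(dvdn_pcharf pchar_closure) Euclid_dvdX // s0.
have := finNzRing_gt1 F; rewrite card_F andbT; case: m => // k _.
by rewrite expnS dvdn_mulr.
Qed.

(** The field with Q = q^s elements is built inside K as F(z), with z of order Q - 1; such z exists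
    because Q - 1 = -1 in K. Elements of F(z) are polynomials in z over F, hence fixed by the Q-th
    power map. *)
Lemma finite_subextension (s : nat) : (0 < s)%N ->
  exists (L : fieldExtType F) (phi : {rmorphism L -> K}),
    [/\ \dim {: L} = s, forall c : F, phi (c%:A) = iota c
      & forall x, phi x ^+ (#|F| ^ s) = phi x].
Proof.
move=> s0; set Q := (#|F| ^ s)%N.
have Q1 : (1 < Q)%N by rewrite -(exp1n s) ltn_exp2r ?finNzRing_gt1.
have [z zQ] : exists z : K, Q.-1.-primitive_root z.
  apply: closed_field_primitive_root.
  by rewrite -subn1 natrB 1?ltnW // natr_card // sub0r oppr_eq0 oner_neq0.
have zfix : z ^+ Q = z.
  by rewrite -(prednK (ltnW Q1)) exprS (prim_expr_order zQ) mulr1.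
(* Membership in the image of a finite field is decided by search; this provides z with a minimal
   polynomial over F. *)
have decF : decidable_embedding iota.
  move=> y; have [/existsP ey|ney] := boolP [exists x, y == iota x].
    by left; case: ey => x /eqP; exists x.
  by right=> -[x yE]; case/negP: ney; apply/existsP; exists x; apply/eqP.
have intz : integralOver iota z.
  exists ('X^(Q.-1) - 1); first by apply: monicXnsubC; lia.
  rewrite rmorphB /= map_polyXn rmorph1 rootE !hornerE.
  by rewrite (prim_expr_order zQ) subrr.
have [f [mon_f fz irr_f]] := minPoly_decidable_closure decF intz.
have f0 : f != 0 by apply: monic_neq0.
pose L : fieldExtType F := SubFieldExtType fz irr_f.
pose phi : {rmorphism L -> K} := @subfx_inj F K iota z f.
have phiA (c : F) : phi (c%:A) = iota c by apply: subfx_inj_base.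
have phifix x : phi x ^+ Q = phi x.
  have [g ->] := subfxE x.
  by rewrite /phi /= subfx_inj_eval // frobenius_horner zfix.
exists L, phi; split=> //.
set d := \dim _; pose fL := finvect_type L.
have cL : #|fL| = (#|F| ^ d)%N.
  by have := card_vspace (fullv : {vspace fL}); rewrite card_vspacef.
have F1 := finNzRing_gt1 F.
(* All units of L are roots of X^(Q-1) - 1. *)
have Qd : (#|F| ^ d <= Q)%N.
  have le_unity : (size (enum (predC1 (0%R : fL))) <= Q.-1)%N.
    apply: max_unity_roots; rewrite ?enum_uniq //; first lia.
    apply/allP => x; rewrite mem_enum !inE => x0; apply/unity_rootP.
    apply: (fmorph_inj phi); rewrite rmorphXn rmorph1.
    have px0 : phi x != 0 by rewrite fmorph_eq0.
    by apply: (mulfI px0); rewrite mulr1 -exprS prednK ?phifix // ltnW.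
  by move: le_unity; rewrite -cardE cardC1 cL; lia.
(* L contains z, so the order Q - 1 of z divides the number of units of L. *)
have dQ : (Q <= #|F| ^ d)%N.
  have : (Q.-1 %| (#|F| ^ d).-1)%N.
    rewrite (prim_order_dvd zQ).
    have z0 : z != 0 by rewrite (prim_root_eq0 zQ); lia.
    have zL : z = phi (subfx_root iota z f).
      by rewrite /phi /= subfx_inj_root.
    rewrite -(inj_eq (mulfI z0)) mulr1 -exprS prednK ?expn_gt0; last first.
      by rewrite ltnW.
    by rewrite -cL zL -rmorphXn (@expf_card fL).
  have d0 : (0 < d)%N by rewrite adim_gt0.
  have : (1 < #|F| ^ d)%N by rewrite -(exp1n d) ltn_exp2r.
  by move=> ? /dvdn_leq; lia.
by apply/eqP; rewrite -(eqn_exp2l _ _ F1) eqn_leq Qd dQ.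
Qed.

End Frobenius.

(** * Fibers of Dickson polynomials *)

Lemma sum_prod_inj (R : idomainType) (s t u v : R) :
  s + t = u + v -> s * t = u * v -> s = u /\ t = v \/ s = v /\ t = u.
Proof.
move=> sumE prodE; have tE : t = u + v - s by rewrite -sumE addrC addKr.
have : (s - u) * (s - v) == 0.
  by apply/eqP; transitivity (u * v - s * t); [rewrite tE|rewrite prodE]; ring.
rewrite mulf_eq0 !subr_eq0 => /orP[] /eqP sE; rewrite tE sE; [left|right];
  by split; [|ring].
Qed.

Lemma closed_field_sum_prod (K : closedFieldType) (y a : K) :
  exists s t, s + t = y /\ s * t = a.
Proof.
have /closed_rootP [s] : size ('X^2 - y *: 'X + a%:P : {poly K}) != 1%N.
  rewrite -addrA size_polyDl size_polyXn //.
  rewrite (leq_ltn_trans (size_polyD _ _)) // gtn_max size_polyN.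
  rewrite (leq_ltn_trans (size_scale_leq _ _)) ?size_polyX //=.
  by rewrite (leq_ltn_trans (size_polyC_leq1 _)).
rewrite rootE !hornerE => /eqP s0; exists s, (y - s); split; first by ring.
by apply/eqP; rewrite -subr_eq0 -oppr_eq0 -s0; apply/eqP; ring.
Qed.

(** The point y_z in the fiber of D_N(-, u v) through u + v, when z^N = 1. *)
Definition fiber_point (K : fieldType) (u v z : K) : K := z * u + z^-1 * v.

Lemma fiber_point1 (K : fieldType) (u v : K) : fiber_point u v 1 = u + v.
Proof. by rewrite /fiber_point invr1 !mul1r. Qed.

Section Fibers.

Variables (K : closedFieldType) (N : nat) (u v : K).
Hypotheses (N_gt0 : (0 < N)%N) (u_neq0 : u != 0) (v_neq0 : v != 0).

Lemma unity_root_neq0 (z : K) : z ^+ N = 1 -> z != 0.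
Proof.
move=> zN; apply/eqP => z0; move/eqP: zN.
by rewrite z0 expr0n eqn0Ngt N_gt0 eq_sym oner_eq0.
Qed.

(** Write y = s + t with s t = u v. Then s^N, t^N and u^N, v^N have the same sum and product, so s/u
    or t/u is an N-th root of unity. *)
Lemma dickson_fiber (y : K) :
  (dickson N (u * v)).[y] = (dickson N (u * v)).[u + v] <->
  exists z, z ^+ N = 1 /\ y = fiber_point u v z.
Proof.
have point z : z ^+ N = 1 -> (dickson N (u * v)).[fiber_point u v z] = u ^+ N + v ^+ N.
  move=> zN; have z0 := unity_root_neq0 zN.
  have <- : (z * u) * (z^-1 * v) = u * v by field.
  by rewrite horner_dickson // !exprMn exprVn zN invr1 !mul1r.
split=> [|[z [zN ->]]]; last by rewrite horner_dickson // point.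
have [s [t [<- stE]]] := closed_field_sum_prod y (u * v).
rewrite horner_dickson // -stE horner_dickson // => sumE.
have prodE : s ^+ N * t ^+ N = u ^+ N * v ^+ N by rewrite -!exprMn stE.
have s0 : s != 0 by move: (mulf_neq0 u_neq0 v_neq0); rewrite -stE mulf_eq0 => /norP[].
have tE : t = u * v / s by rewrite -stE; field.
case: (sum_prod_inj sumE prodE) => -[sN tN].
  exists (s / u); split; first by rewrite exprMn exprVn sN divff ?expf_neq0.
  by rewrite /fiber_point tE; field; apply/andP.
exists (t / u); split; first by rewrite exprMn exprVn tN divff ?expf_neq0.
by rewrite /fiber_point tE; field; apply/and3P.
Qed.

(** Puts the condition on the derivative into the form used to compare fiber points. *)
Lemma deriv_dickson_neq0 :
  (dickson N (u * v))^`().[u + v] != 0 -> u ^+ N = v ^+ N -> u = v.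
Proof.
move=> D0 uv; have := horner_deriv_dickson u v N_gt0.
rewrite uv subrr mulr0 => /eqP; rewrite mulf_eq0 (negbTE D0) orbF subr_eq0.
by move/eqP.
Qed.

(** The pairs (z u, v/z) and (w u, v/w) have equal sum and product, so they agree up to order; in
    the crossed case z u = v/w, taking N-th powers gives u^N = v^N. *)
Lemma fiber_point_inj (z w : K) : (u ^+ N = v ^+ N -> u = v) ->
  z ^+ N = 1 -> w ^+ N = 1 -> fiber_point u v z = fiber_point u v w ->
  z = w \/ u = v /\ z = w^-1.
Proof.
move=> uvN zN wN zw; have z0 := unity_root_neq0 zN; have w0 := unity_root_neq0 wN.
have prodE : (z * u) * (z^-1 * v) = (w * u) * (w^-1 * v).
  by field; rewrite z0 w0.
case: (sum_prod_inj zw prodE) => -[E _]; first by left; apply: (mulIf u_neq0).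
right; have uv : u = v.
  apply: uvN; have := congr1 (fun x => x ^+ N) E.
  by rewrite !exprMn exprVn zN wN invr1 !mul1r.
by split=> //; apply: (mulIf u_neq0); rewrite E uv.
Qed.

End Fibers.

(** * The roots of h_g(-x) *)

Lemma root_h_poly (F : fieldType) (g : {poly F}) (x : F) :
  g.[0] = 0 -> g^`().[0] != 0 ->
  root (h_poly g) x = (x != 0) && (g.[x] == 0).
Proof.
move=> g0 dg0; have gE : h_poly g * 'X = g.
  by rewrite /h_poly g0 subr0 divpK // -['X]subr0 -polyC0 dvdp_XsubCl rootE g0.
have [->|x0] := eqVneq x 0.
  apply/negbTE; rewrite rootE; apply: contra dg0 => /eqP h0.
  by rewrite -gE derivM derivX !hornerE h0.
by rewrite rootE -[in RHS]gE !hornerE mulf_eq0 (negbTE x0) orbF.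
Qed.

Lemma h_poly_compN (F : fieldType) (g : {poly F}) : g.[0] = 0 ->
  (g \Po (- 'X)) %/ (- 'X) = h_poly g \Po (- 'X).
Proof.
move=> g0; have gE : h_poly g * 'X = g.
  by rewrite /h_poly g0 subr0 divpK // -['X]subr0 -polyC0 dvdp_XsubCl rootE g0.
by rewrite -[in LHS]gE comp_polyM comp_polyX mulpK // oppr_eq0 polyX_eq0.
Qed.

Lemma shifted_dickson_0 (R : comNzRingType) (N : nat) (a e : R) :
  (shifted_dickson N a e).[0] = 0.
Proof.
by rewrite /shifted_dickson !hornerE horner_comp !hornerE ?add0r subrr.
Qed.

Lemma deriv_shifted_dickson_0 (R : comNzRingType) (N : nat) (a e : R) :
  (shifted_dickson N a e)^`().[0] = (dickson N a)^`().[e].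
Proof.
rewrite /shifted_dickson derivB derivC subr0 deriv_comp derivD derivX derivC.
by rewrite addr0 mulr1 horner_comp !hornerE ?add0r.
Qed.

Lemma map_shifted_dickson (R S : nzRingType) (f : {rmorphism R -> S}) N (a e : R) :
  map_poly f (shifted_dickson N a e) = shifted_dickson N (f a) (f e).
Proof.
rewrite /shifted_dickson rmorphB /= map_comp_poly map_polyC /= rmorphD /=.
by rewrite map_polyX map_polyC /= -horner_map /= map_dickson.
Qed.

Lemma horner_shifted_dickson (R : comNzRingType) (N : nat) (a e x : R) :
  (shifted_dickson N a e).[x] = (dickson N a).[x + e] - (dickson N a).[e].
Proof. by rewrite /shifted_dickson !hornerE horner_comp !hornerE. Qed.

Lemma map_h_poly (F K : fieldType) (f : {rmorphism F -> K}) (g : {poly F}) :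
  map_poly f (h_poly g) = h_poly (map_poly f g).
Proof.
rewrite /h_poly map_divp map_polyX rmorphB /= map_polyC.
by rewrite -[in RHS](rmorph0 f) horner_map.
Qed.

(** The roots x correspond to the points y = e - x of the fiber of e other than e itself: 0 is a
    simple root of g, and y_z = e only for z = 1. *)
Lemma root_shifted_dickson (F : fieldType) (K : closedFieldType)
    (iota : {rmorphism F -> K}) (N : nat) (a e : F) (u v x : K) :
  (0 < N)%N -> u * v = iota a -> u + v = iota e -> a != 0 ->
  (dickson N a)^`().[e] != 0 ->
  root (map_poly iota (h_poly (shifted_dickson N a e) \Po (- 'X))) x <->
  exists z, [/\ z ^+ N = 1, z != 1 & x = iota e - fiber_point u v z].
Proof.
move=> N0 uvE eE a0 D0.
have uv0 : u * v != 0 by rewrite uvE fmorph_eq0.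
have [u0 v0] : u != 0 /\ v != 0 by apply/andP; rewrite -negb_or -mulf_eq0.
have D0' : (dickson N (u * v))^`().[u + v] != 0.
  by rewrite uvE eE -map_dickson deriv_map horner_map fmorph_eq0.
rewrite map_comp_poly map_h_poly map_shifted_dickson rmorphN /= map_polyX.
rewrite rootE horner_comp !hornerE -rootE -uvE -eE root_h_poly; first last.
- by rewrite deriv_shifted_dickson_0.
- by rewrite shifted_dickson_0.
rewrite horner_shifted_dickson subr_eq0 oppr_eq0.
split=> [/andP[x0 /eqP /dickson_fiber []]|[z [zN z1 ->]]] //.
  move=> z [zN zE]; exists z; split=> //; last by rewrite -zE; ring.
  apply: contra x0 => /eqP z1; move: zE; rewrite z1 fiber_point1.
  rewrite -[RHS]add0r => /addIr/eqP; by rewrite oppr_eq0.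
rewrite opprB subrK; apply/andP; split; last first.
  by apply/eqP/dickson_fiber => //; exists z.
apply: contra z1; rewrite subr_eq0 -(fiber_point1 u v) => /eqP/esym.
case/(fiber_point_inj N0 u0 (deriv_dickson_neq0 N0 D0') zN (expr1n _ _)).
  by move=> ->.
by move=> [_ ->]; rewrite invr1.
Qed.

(** * Exceptionality and the Frobenius orbits of the roots *)

Section FrobeniusOrbit.

Variables (p m : nat) (F : finFieldType) (K : closedFieldType).
Variable iota : {rmorphism F -> K}.
Hypotheses (p_prime : prime p) (card_F : #|F| = (p ^ m)%N).

Lemma frobenius_swap (s : nat) (c d : F) (u v : K) :
  u + v = iota c -> u * v = iota d ->
  u ^+ (#|F| ^ s) = u /\ v ^+ (#|F| ^ s) = v \/
  u ^+ (#|F| ^ s) = v /\ v ^+ (#|F| ^ s) = u.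
Proof.
move=> sE dE; apply: sum_prod_inj.
  by rewrite -(frobeniusD iota p_prime card_F) sE frobenius_iota.
by rewrite -exprMn dE frobenius_iota.
Qed.

Lemma frobenius_double (s : nat) (x : K) :
  x ^+ (#|F| ^ s.*2) = (x ^+ (#|F| ^ s)) ^+ (#|F| ^ s).
Proof. by rewrite -exprM -expnD addnn. Qed.

(** Let y = u + v with u v = a, and x = y_z. Both u and z u are fixed by the 2s-th power of
    Frobenius, hence so is z. *)
Lemma dickson_inj_fixed (N s : nat) (a : F) (x y : K) : (0 < N)%N -> a != 0 ->
  (forall z : K, z ^+ N = 1 -> z ^+ (#|F| ^ s.*2) = z -> z = 1) ->
  x ^+ (#|F| ^ s) = x -> y ^+ (#|F| ^ s) = y ->
  (dickson N (iota a)).[x] = (dickson N (iota a)).[y] -> x = y.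
Proof.
move=> N0 a0 unity1 xQ yQ.
(* Frobenius at most swaps two elements with rational sum and product. *)
have fixed2 (u v : K) : (u + v) ^+ (#|F| ^ s) = u + v -> u * v = iota a ->
    u ^+ (#|F| ^ s.*2) = u.
  move=> uvQ uva; rewrite frobenius_double.
  have : u ^+ (#|F| ^ s) = u /\ v ^+ (#|F| ^ s) = v \/
         u ^+ (#|F| ^ s) = v /\ v ^+ (#|F| ^ s) = u.
    apply: sum_prod_inj; first by rewrite -(frobeniusD iota p_prime card_F).
    by rewrite -exprMn uva frobenius_iota.
  by case=> -[uE vE]; rewrite uE.
have [u [v [yE uva]]] := closed_field_sum_prod y (iota a).
have : u * v != 0 by rewrite uva fmorph_eq0.
rewrite mulf_eq0 => /norP[u0 v0].
rewrite -uva -yE => /(dickson_fiber N0 u0 v0) [z [zN xE]].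
have z0 := unity_root_neq0 N0 zN.
suff z1 : z = 1 by rewrite xE z1 fiber_point1.
apply: unity1 => //; apply: (mulIf u0).
have uQ : u ^+ (#|F| ^ s.*2) = u by apply: (fixed2 u v) => //; rewrite yE.
rewrite -[in LHS]uQ -exprMn; apply: (fixed2 _ (z^-1 * v)).
  by rewrite -/(fiber_point u v z) -xE.
by rewrite -uva; field.
Qed.

(** A finite field is permuted by any injective self-map, and injectivity is tested after embedding
    into K. *)
Lemma shifted_dickson_permutes (N s : nat) (a e : F) :
  (0 < N)%N -> a != 0 -> (0 < s)%N ->
  (forall z : K, z ^+ N = 1 -> z ^+ (#|F| ^ s.*2) = z -> z = 1) ->
  permutes_ext (shifted_dickson N a e) s.
Proof.
move=> N0 a0 s0 unity1.
have [L [phi [dimL phiA phifix]]] := finite_subextension iota p_prime card_F s0.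
exists L; split=> //; apply: (@injF_bij (finvect_type L)) => x y /= xy.
have phi_in_alg : phi \o in_alg L =1 iota by move=> c; apply: phiA.
have phiE (z : L) : phi (map_poly (in_alg L) (shifted_dickson N a e)).[z] =
    (dickson N (iota a)).[phi z + iota e] - (dickson N (iota a)).[iota e].
  rewrite -horner_map -map_poly_comp (eq_map_poly phi_in_alg).
  by rewrite map_shifted_dickson horner_shifted_dickson.
apply: (fmorph_inj phi); have := congr1 phi xy; rewrite !phiE => /addIr eqD.
apply: (addIr (iota e)); apply: (dickson_inj_fixed N0 a0 unity1 _ _ eqD);
  by rewrite (frobeniusD iota p_prime card_F) frobenius_iota; congr (_ + _);
  exact: phifix.
Qed.

Lemma shifted_dickson_exceptional (n : nat) (a e : F) : a != 0 -> prime n.+1 ->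
  ~~ (n.+1 %| #|F|)%N -> ~~ (n.+1 %| #|F| ^ 2 - 1)%N ->
  exceptional (shifted_dickson n.+1 a e).
Proof.
(* For s = 1 modulo n, Euler's theorem gives q^(2s) = q^2 modulo N, and N does not divide q^2 -
   1. *)
move=> a0 prN NF NF2 M; exists (n * M).+1.
have n0 : (0 < n)%N by have := prime_gt1 prN.
split; first by rewrite ltnS leq_pmull.
apply: shifted_dickson_permutes => // z zN.
have z0 := unity_root_neq0 (ltn0Sn n) zN.
have zn : z ^+ (#|F| ^ n) = z.
  have Fn0 : (0 < #|F| ^ n)%N by rewrite expn_gt0 ltnW ?finNzRing_gt1.
  have /dvdnP [k kE] : (n.+1 %| (#|F| ^ n).-1)%N.
    rewrite -subn1 -eqn_mod_dvd // -[X in (_ ^ X)%N](totient_prime prN).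
    by apply/eqP/Euler_exp_totient; rewrite coprime_sym prime_coprime.
  by rewrite -(prednK Fn0) kE exprS mulnC exprM zN expr1n mulr1.
have -> : (#|F| ^ (n * M).+1.*2 = (#|F| ^ n) ^ M.*2 * #|F| ^ 2)%N.
  by rewrite -expnM -expnD; congr (_ ^ _)%N; lia.
rewrite exprM (expr_fixed_iter _ zn) => z2.
have F2 : (0 < #|F| ^ 2)%N by rewrite expn_gt0 ltnW ?finNzRing_gt1.
have z21 : z ^+ (#|F| ^ 2 - 1) = 1.
  by apply: (mulfI z0); rewrite -exprS subn1 prednK // mulr1.
have [d zd dN] := prim_order_exists (ltn0Sn n) zN.
have dNF : (d %| #|F| ^ 2 - 1)%N by rewrite (prim_order_dvd zd) z21.
have [_ /(_ d dN) /orP[] /eqP dE] := primeP prN; last by rewrite dE (negbTE NF2) in dNF.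
by rewrite dE in zd; have := prim_expr_order zd; rewrite expr1.
Qed.

Variables (n : nat) (zeta : K).
Hypotheses (N_prime : prime n.+1) (zeta_prim : n.+1.-primitive_root zeta).
Hypothesis NF : ~~ (n.+1 %| #|F|)%N.

(** Indexes the N-th roots of unity by residues, so that z -> z^c becomes multiplication by c in a
    prime field, and inversion becomes negation. *)
Definition Fp_expr (s : 'F_n.+1) : K := zeta ^+ s.

Lemma Fp_expr_nat (i : nat) : Fp_expr i%:R = zeta ^+ i.
Proof. by rewrite /Fp_expr val_Fp_nat // (prim_expr_mod zeta_prim). Qed.

Lemma Fp_nat (s : 'F_n.+1) : s = (s : nat)%:R.
Proof. by rewrite natr_Zp. Qed.

Lemma Fp_exprD (s t : 'F_n.+1) : Fp_expr (s + t) = Fp_expr s * Fp_expr t.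
Proof. by rewrite {1}[s]Fp_nat {1}[t]Fp_nat -natrD Fp_expr_nat exprD. Qed.

Lemma Fp_expr0 : Fp_expr 0 = 1.
Proof. by rewrite (Fp_expr_nat 0). Qed.

Lemma Fp_exprM (s : 'F_n.+1) (i : nat) : Fp_expr (s * i%:R) = Fp_expr s ^+ i.
Proof. by rewrite {1}[s]Fp_nat -natrM Fp_expr_nat exprM. Qed.

Lemma Fp_expr_unity (s : 'F_n.+1) : Fp_expr s ^+ n.+1 = 1.
Proof. by rewrite exprAC (prim_expr_order zeta_prim) expr1n. Qed.

Lemma Fp_expr_neq0 (s : 'F_n.+1) : Fp_expr s != 0.
Proof. exact (unity_root_neq0 (ltn0Sn n) (Fp_expr_unity s)). Qed.

Lemma Fp_exprN (s : 'F_n.+1) : Fp_expr (- s) = (Fp_expr s)^-1.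
Proof.
apply: (mulIf (Fp_expr_neq0 s)); rewrite -Fp_exprD addNr Fp_expr0.
by rewrite mulVf ?Fp_expr_neq0.
Qed.

Lemma Fp_expr_inj : injective Fp_expr.
Proof.
move=> s t; rewrite [s]Fp_nat [t]Fp_nat !Fp_expr_nat => /eqP.
rewrite (eq_prim_root_expr zeta_prim) => /eqP eqm.
by apply/val_inj; rewrite /= !val_Fp_nat.
Qed.

Lemma Fp_expr_surj (z : K) : z ^+ n.+1 = 1 -> exists s, z = Fp_expr s.
Proof.
by move=> /(prim_rootP zeta_prim)[i ->]; exists i%:R; rewrite Fp_expr_nat.
Qed.

Lemma card_Fp_nat_neq0 : (#|F|%:R : 'F_n.+1) != 0.
Proof. by rewrite -(dvdn_pcharf (pchar_Fp N_prime)). Qed.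

Variables (a e : F) (u v : K).
Hypotheses (a_neq0 : a != 0) (uvE : u * v = iota a) (eE : u + v = iota e).
Hypothesis D_neq0 : (dickson n.+1 a)^`().[e] != 0.

Let u_neq0 : u != 0.
Proof.
have : u * v != 0 by rewrite uvE fmorph_eq0.
by rewrite mulf_eq0 => /norP[].
Qed.

Let v_neq0 : v != 0.
Proof.
have : u * v != 0 by rewrite uvE fmorph_eq0.
by rewrite mulf_eq0 => /norP[].
Qed.

Let uv_pow : u ^+ n.+1 = v ^+ n.+1 -> u = v.
Proof.
apply: deriv_dickson_neq0 => //.
by rewrite uvE eE -map_dickson deriv_map horner_map fmorph_eq0.
Qed.

Local Notation hroot :=
  (root (map_poly iota (h_poly (shifted_dickson n.+1 a e) \Po (- 'X)))).

Local Notation pt s := (iota e - fiber_point u v (Fp_expr s)).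

Lemma hrootP (x : K) : hroot x <-> exists2 s : 'F_n.+1, s != 0 & x = pt s.
Proof.
rewrite (root_shifted_dickson x (ltn0Sn n) uvE eE a_neq0 D_neq0); split.
  case=> z [/Fp_expr_surj [s ->] s1 xE]; exists s => //.
  by apply: contra s1 => /eqP ->; rewrite Fp_expr0.
case=> s s0 xE; exists (Fp_expr s); split=> //; first exact: Fp_expr_unity.
by rewrite -Fp_expr0 (inj_eq Fp_expr_inj).
Qed.

Lemma pt_inj (s t : 'F_n.+1) : pt s = pt t -> s = t \/ u = v /\ s = - t.
Proof.
move=> /addrI/oppr_inj/(fiber_point_inj (ltn0Sn n) u_neq0 uv_pow
  (Fp_expr_unity s) (Fp_expr_unity t)).
case=> [/Fp_expr_inj ->|[uv stE]]; [by left|right; split=> //].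
by apply: Fp_expr_inj; rewrite Fp_exprN.
Qed.

Lemma ptN (s : 'F_n.+1) : u = v -> pt (- s) = pt s.
Proof.
by move=> uv; rewrite /fiber_point Fp_exprN invrK uv; congr (_ - _); rewrite addrC.
Qed.

Lemma frobenius_pt (s : 'F_n.+1) : u ^+ #|F| = u -> v ^+ #|F| = v ->
  (pt s) ^+ #|F| = pt (s * #|F|%:R).
Proof.
move=> uq vq; have := frobeniusB iota p_prime card_F 1.
rewrite expn1 => ->; rewrite -rmorphXn expf_card /fiber_point.
have := frobeniusD iota p_prime card_F 1; rewrite expn1 => ->.
by rewrite !exprMn uq vq Fp_exprM exprVn.
Qed.

Lemma frobenius_pt_swap (s : 'F_n.+1) : u ^+ #|F| = v -> v ^+ #|F| = u ->
  (pt s) ^+ #|F| = pt (s * - #|F|%:R).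
Proof.
move=> uq vq; have := frobeniusB iota p_prime card_F 1.
rewrite expn1 => ->; rewrite -rmorphXn expf_card /fiber_point.
have := frobeniusD iota p_prime card_F 1; rewrite expn1 => ->.
rewrite !exprMn uq vq mulrN Fp_exprN Fp_exprM exprVn invrK.
by congr (_ - _); exact: addrC.
Qed.

(** The orbit of [pt t] consists of the [pt (t * c ^+ k)], and distinct residues give equal points
    only if u = v and they are opposite. *)
Lemma single_orbit_powers (c : 'F_n.+1) : c != 0 ->
  (forall s, (pt s) ^+ #|F| = pt (s * c)) ->
  (exists b, forall x, hroot x <-> exists k : nat, x = b ^+ (#|F| ^ k)) <->
  (forall s, s != 0 -> exists k : nat, s = c ^+ k \/ u = v /\ s = - c ^+ k).
Proof.
move=> c0 ptF.
have ptFk s k : (pt s) ^+ (#|F| ^ k) = pt (s * c ^+ k).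
  elim: k s => [|k IH] s; first by rewrite expr0 mulr1.
  by rewrite expnS exprM ptF IH exprS mulrA.
split=> [[b bP] s s0|powc]; last first.
  exists (pt 1) => x; rewrite hrootP; split=> [[s s0 ->]|[k ->]]; last first.
    by exists (c ^+ k); rewrite ?expf_neq0 // ptFk mul1r.
  have [k sE] := powc s s0; exists k; rewrite ptFk mul1r.
  by case: sE => [->|[uv ->]] //; rewrite ptN.
have /hrootP [t t0 bE] : hroot b by apply/bP; exists 0%N; rewrite expr1.
(* The orbit may start at any residue t; reaching t s from t and cancelling t expresses s by a power
   of c. *)
have /bP [k] : hroot (pt (t * s)).
  by apply/hrootP; exists (t * s); rewrite // mulf_neq0.
rewrite bE ptFk => /pt_inj ptE; exists k; case: ptE => [/(mulfI t0)|[uv]].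
  by left.
by rewrite -mulrN => /(mulfI t0) ->; right.
Qed.

Lemma single_orbit_fixed : u <> v -> u ^+ #|F| = u -> v ^+ #|F| = v ->
  (exists b, forall x, hroot x <-> exists k : nat, x = b ^+ (#|F| ^ k)) <->
  n.-primitive_root (#|F|%:R : 'F_n.+1).
Proof.
move=> uv uq vq.
have c0 := card_Fp_nat_neq0.
rewrite -(@primitive_root_powers _ n (card_Fp N_prime)) //; last first.
  by have := prime_gt1 N_prime.
rewrite (single_orbit_powers c0) => [|s]; last exact: frobenius_pt.
by split=> H s /H [k]; [case=> [->|[]] //; exists k|move=> ->; exists k; left].
Qed.

Lemma single_orbit_swap : u <> v -> u ^+ #|F| = v -> v ^+ #|F| = u ->
  (exists b, forall x, hroot x <-> exists k : nat, x = b ^+ (#|F| ^ k)) <->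
  n.-primitive_root (- #|F|%:R : 'F_n.+1).
Proof.
move=> uv uq vq.
have c0 : - #|F|%:R != 0 :> 'F_n.+1 by rewrite oppr_eq0 card_Fp_nat_neq0.
rewrite -(@primitive_root_powers _ n (card_Fp N_prime)) //; last first.
  by have := prime_gt1 N_prime.
rewrite (single_orbit_powers c0) => [|s]; last exact: frobenius_pt_swap.
by split=> H s /H [k]; [case=> [->|[]] //; exists k|move=> ->; exists k; left].
Qed.

(** For u = v a swap changes nothing, so c = q, and [ptN] identifies opposite residues. *)
Lemma single_orbit_double : ~~ odd n -> u = v ->
  (exists b, forall x, hroot x <-> exists k : nat, x = b ^+ (#|F| ^ k)) <->
  n.-primitive_root (#|F|%:R : 'F_n.+1) \/
  odd n./2 /\ n./2.-primitive_root (#|F|%:R : 'F_n.+1).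
Proof.
move=> n_even uv; have c0 := card_Fp_nat_neq0.
have n0 : (0 < n)%N by have := prime_gt1 N_prime.
have two0 : 2%:R != 0 :> 'F_n.+1.
  rewrite -(dvdn_pcharf (pchar_Fp N_prime)) gtnNdvd //.
  by case: n n0 n_even => [|[]].
have [uq vq] : u ^+ #|F| = u /\ v ^+ #|F| = v.
  by have := frobenius_swap 1 eE uvE; rewrite expn1 -uv => -[].
rewrite -(@primitive_root_signed_powers _ n (card_Fp N_prime)) //.
rewrite (single_orbit_powers c0) => [|s]; last exact: frobenius_pt.
split=> H s /H [k sE]; exists k; case: sE; [by left|by case; right|by left|].
by right.
Qed.

End FrobeniusOrbit.

(** * Artin-Schreier equations and the case distinction *)

Section CharTwo.

Variable K : fieldType.
Hypothesis char2 : 2%N \in [pchar K].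

Lemma two_eq0 : 2%:R = 0 :> K.
Proof. exact: pcharf0. Qed.

Lemma sqrrD_char2 (x y : K) : (x + y) ^+ 2 = x ^+ 2 + y ^+ 2.
Proof. by rewrite sqrrD mulr2n addrr_pchar2 // addr0. Qed.

Lemma abs_trace2_pow2 (M : nat) (x : K) :
  abs_trace2 (2 ^ M) x = \sum_(j < M) x ^+ (2 ^ j).
Proof. by rewrite /abs_trace2 pfactorK. Qed.

(** The sum telescopes in characteristic 2. *)
Lemma abs_trace2_artin_schreier (M : nat) (x : K) :
  abs_trace2 (2 ^ M) (x ^+ 2 + x) = x ^+ (2 ^ M) + x.
Proof.
rewrite abs_trace2_pow2; elim: M => [|M IH].
  by rewrite big_ord0 expr1 addrr_pchar2.
have frob (y z : K) : (y + z) ^+ (2 ^ M) = y ^+ (2 ^ M) + z ^+ (2 ^ M).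
  by rewrite exprDn_pchar // (eq_pnat _ (pcharf_eq char2)) pnatX pnat_id.
rewrite big_ord_recr /= IH frob -exprM -expnS.
rewrite [_ + x ^+ (2 ^ M)]addrC addrACA addrr_pchar2 // add0r.
exact: addrC.
Qed.

(** Explicit additive Hilbert 90: when d has trace 0, [as_root] solves X^2 + X = d. Its coefficients
    are the partial traces E_j of eps, which satisfy E_j^2 = E_(j+1) - eps. *)
Lemma as_root_artin_schreier (M : nat) (eps d : K) :
  abs_trace2 (2 ^ M) eps = 1 -> d ^+ (2 ^ M) = d ->
  as_root (2 ^ M) eps d ^+ 2 + as_root (2 ^ M) eps d =
  eps * abs_trace2 (2 ^ M) d + d.
Proof.
rewrite !abs_trace2_pow2 /as_root pfactorK //; case: M => [|M].
  by rewrite big_ord0 => /esym/eqP; rewrite oner_eq0.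
pose E j := \sum_(k < j) eps ^+ (2 ^ k); rewrite -/(E M.+1).
pose B k := \sum_(1 <= j < k) E j * d ^+ (2 ^ j).
have sqrE j : E j ^+ 2 = E j.+1 - eps.
  rewrite /E big_ord_recl expr1 addrC addKr.
  elim: j => [|j IH]; first by rewrite !big_ord0 expr0n.
  by rewrite !big_ord_recr /= sqrrD_char2 IH -exprM -expnSr.
(* Squaring shifts the index, so neighbouring terms cancel up to eps and one boundary term remains
   at the top. *)
have BE k : B k.+1 ^+ 2 + B k.+1 =
    eps * (\sum_(j < k.+1) d ^+ (2 ^ j) - d) + (E k.+1 - eps) * d ^+ (2 ^ k.+1).
  elim: k => [|k IH].
    by rewrite /B big_geq // /E !big_ord1 !expr1 !subrr mulr0 mul0r expr0n !addr0.
  rewrite {1 2}/B big_nat_recr //= -/(B k.+1) sqrrD_char2 addrACA IH.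
  rewrite exprMn sqrE -exprM -expnSr.
  rewrite [in RHS]big_ord_recr /=.
  set X := d ^+ (2 ^ k.+1); set Y := d ^+ (2 ^ k.+2).
  set S := \sum_(j < k.+1) d ^+ (2 ^ j).
  (* With this multiple of 2 written out, the identity holds in every commutative ring;
     characteristic 2 then removes it. *)
  transitivity (eps * (S + X - d) + (E k.+2 - eps) * Y + 2%:R * ((E k.+1 - eps) * X)).
    by ring.
  by rewrite two_eq0 mul0r addr0.
(* Trace 1 for eps and d^(2^(M+1)) = d turn the boundary term into (1 - eps) d. *)
rewrite -/(B M.+1) => E1 dM; rewrite BE E1 dM; set S := \sum_(j < _) d ^+ (2 ^ j).
transitivity (eps * S + d - 2%:R * (eps * d)); first by ring.
by rewrite two_eq0 mul0r subr0.
Qed.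

Lemma artin_schreier_inj (x y : K) : x ^+ 2 + x = y ^+ 2 + y -> x = y \/ x = y + 1.
Proof.
move=> xy; have : (x - y) * (x - (y + 1)) == 0.
  apply/eqP; transitivity ((x ^+ 2 + x) - (y ^+ 2 + y) + 2%:R * (y ^+ 2 + y - x * y - x)).
    by ring.
  by rewrite xy subrr two_eq0 mul0r addr0.
by rewrite mulf_eq0 !subr_eq0 => /orP[] /eqP; [left|right].
Qed.

Variables (u v z : K).
Hypotheses (z_neq0 : z != 0) (z1_neq0 : 1 + z != 0) (uv_neq0 : u + v != 0).

(** A sum of two solutions: X^2 + X takes z/(1+z) to 1/(z + 1/z) and u/(u+v) to u v/(u+v)^2. *)
Definition artin_schreier_point : K := z / (1 + z) + u / (u + v).

Local Notation P := artin_schreier_point.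

Lemma alpha_char2 : z + z^-1 = (1 + z) ^+ 2 / z.
Proof. by rewrite sqrrD_char2; field. Qed.

Lemma delta_artin_schreier :
  (z + z^-1)^-1 + u * v / (u + v) ^+ 2 = P ^+ 2 + P.
Proof.
rewrite alpha_char2 /P.
transitivity ((z / (1 + z) + u / (u + v)) ^+ 2 + (z / (1 + z) + u / (u + v))
  - 2%:R * ((z / (1 + z)) ^+ 2 + (u / (u + v)) ^+ 2 + (z / (1 + z)) * (u / (u + v)))).
  by field; apply/and3P.
by rewrite two_eq0 mul0r subr0.
Qed.

(** After division by (z + 1/z)(u + v), the roots for 1/z and z become the two Artin-Schreier
    solutions P and P + 1. *)
Lemma fiber_point_artin_schreier :
  u + v - fiber_point u v z^-1 = (z + z^-1) * (u + v) * P.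
Proof.
rewrite alpha_char2 /fiber_point /P invrK.
transitivity ((1 + z) ^+ 2 / z * (u + v) * (z / (1 + z) + u / (u + v))
  - 2%:R * (z * u + u + z^-1 * u + z * v)).
  by field; apply/and3P.
by rewrite two_eq0 mul0r subr0.
Qed.

Lemma fiber_point_artin_schreier1 :
  u + v - fiber_point u v z = (z + z^-1) * (u + v) * (P + 1).
Proof.
rewrite mulrDr -fiber_point_artin_schreier /fiber_point invrK mulr1.
transitivity (u + v - (z^-1 * u + z * v) + (z + z^-1) * (u + v)
  - 2%:R * (z * u + z^-1 * v)); first by ring.
by rewrite two_eq0 mul0r subr0.
Qed.

End CharTwo.

(** * Orbit criterion and root formulas *)

Section Main.

Variables (p m : nat) (F : finFieldType) (K : closedFieldType).
Variable iota : {rmorphism F -> K}.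
Hypotheses (p_prime : prime p) (card_F : #|F| = (p ^ m)%N).
Variables (n : nat) (zeta : K).
Hypotheses (n_ge2 : (1 < n)%N) (N_prime : prime n.+1).
Hypothesis (zeta_prim : n.+1.-primitive_root zeta).
Hypothesis N_neq_p : n.+1 <> p.
Variables (a e : F) (u v : K).
Hypotheses (a_neq0 : a != 0) (uvE : u * v = iota a) (eE : u + v = iota e).
Hypothesis D_neq0 : (dickson n.+1 a)^`().[e] != 0.

Local Notation hroot :=
  (root (map_poly iota (h_poly (shifted_dickson n.+1 a e) \Po (- 'X)))).

Lemma N_ndvd_card : ~~ (n.+1 %| #|F|)%N.
Proof.
by rewrite card_F Euclid_dvdX // dvdn_prime2 // negb_and; move/eqP: N_neq_p => ->.
Qed.

Lemma n_even : ~~ odd n.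
Proof. by case: (even_prime N_prime) => //; lia. Qed.

Lemma good_single_orbit : ~~ (n.+1 %| #|F| ^ 2 - 1)%N ->
  good iota (shifted_dickson n.+1 a e) <->
  (exists b, forall x, hroot x <-> exists k : nat, x = b ^+ (#|F| ^ k)).
Proof.
move=> NF2; rewrite /good h_poly_compN ?shifted_dickson_0 // deriv_shifted_dickson_0.
split=> [[]//|orb]; split=> //.
exact (shifted_dickson_exceptional iota p_prime card_F e a_neq0 N_prime
  N_ndvd_card NF2).
Qed.

Lemma hroot_half (x : K) : hroot x <->
  exists i, (1 <= i <= n./2)%N /\
    (x = iota e - fiber_point u v (zeta ^+ i) \/
     x = iota e - fiber_point u v (zeta ^- i)).
Proof.
have zetaN := prim_expr_order zeta_prim.
rewrite (root_shifted_dickson x (ltn0Sn n) uvE eE a_neq0 D_neq0); split.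
  case=> z [/(prim_rootP zeta_prim) [j ->]].
  rewrite -(prim_order_dvd zeta_prim) => jN ->.
  have j0 : (0 < j)%N by case: (j : nat) jN; rewrite ?dvdn0.
  have [le_j|lt_j] := leqP j n./2; first by exists j; rewrite j0 le_j; split; last left.
  (* Exponents above n/2 are folded back by zeta^j = zeta^-(N-j). *)
  exists (n.+1 - j)%N; split; last right.
    by have := ltn_ord j; have := n_even; lia.
  congr (_ - fiber_point u v _); apply: (mulIf (x := zeta ^+ (n.+1 - j))).
    by rewrite expf_neq0 // (prim_root_eq0 zeta_prim).
  rewrite mulVf ?expf_neq0 ?(prim_root_eq0 zeta_prim) // -exprD subnKC //.
  exact/ltnW.
case=> i [/andP[i0 le_i] xE].
have iN : zeta ^+ i != 1.
  by rewrite -(prim_order_dvd zeta_prim) gtnNdvd //; lia.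
case: xE => ->; [exists (zeta ^+ i)|exists (zeta ^- i)]; split=> //.
- by rewrite exprAC zetaN expr1n.
- by rewrite exprVn exprAC zetaN expr1n invr1.
- by rewrite invr_eq1.
Qed.

(** * Odd characteristic: the discriminant e^2 - 4a *)

Section OddCharacteristic.

Hypothesis p_neq2 : p <> 2%N.

Let two_neq0 : 2%:R != 0 :> K.
Proof.
rewrite -(dvdn_pcharf (pchar_closure iota p_prime card_F)).
by rewrite dvdn_prime2 //; apply/eqP.
Qed.

Let sqr_uvB : (u - v) ^+ 2 = iota (e ^+ 2 - 4%:R * a).
Proof. by rewrite rmorphB rmorphXn rmorphM rmorph_nat /= -uvE -eE; ring. Qed.

Let uE : u = 2%:R^-1 * (iota e + (u - v)).
Proof. by rewrite -eE; field. Qed.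

Lemma disc_eq0 : u = v <-> e ^+ 2 - 4%:R * a = 0.
Proof.
split=> [uv|D0].
  by apply: (fmorph_inj iota); rewrite -sqr_uvB uv subrr (rmorph0 iota) expr0n.
apply/eqP; rewrite -subr_eq0 -sqrf_eq0 sqr_uvB D0 rmorph0 //.
Qed.

(** u = (e + (u - v))/2, where u - v is a square root of the discriminant; so u is rational exactly
    when this root is. *)
Lemma disc_square : is_square (e ^+ 2 - 4%:R * a) <-> u ^+ #|F| = u.
Proof.
split=> [[y yD]|/(frobenius_fixed iota)[c cE]].
  have : (u - v) ^+ 2 == iota y ^+ 2 by rewrite sqr_uvB -yD rmorphXn.
  rewrite eqf_sqr => uvy.
  have [c ->] : exists c, u = iota c.
    exists (2%:R^-1 * (e + (if u - v == iota y then y else - y))).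
    rewrite rmorphM fmorphV rmorph_nat rmorphD /= [LHS]uE.
    case: ifP uvy => [/eqP -> //|_ /= /eqP ->]; by rewrite rmorphN.
  by rewrite -rmorphXn expf_card.
exists (2%:R * c - e); apply: (fmorph_inj iota).
rewrite -sqr_uvB rmorphXn rmorphB rmorphM rmorph_nat /= -cE -eE; congr (_ ^+ 2).
by ring.
Qed.

Lemma single_orbit_odd_char :
  (exists b, forall x, hroot x <-> exists k : nat, x = b ^+ (#|F| ^ k)) <->
  case_i p #|F| n \/ case_ii p #|F| n a e.
Proof.
rewrite /case_i /case_ii !order_mod_Fp //; set c := (#|F|%:R : 'F_n.+1).
have c0 : c != 0 by apply: card_Fp_nat_neq0 N_ndvd_card.
have n0 : (0 < n)%N by lia.
have two0 : 2%:R != 0 :> 'F_n.+1.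
  by rewrite -(dvdn_pcharf (pchar_Fp N_prime)) gtnNdvd.
have opp := primitive_root_oppf (card_Fp N_prime) n0 n_even two0 c0.
have [/eqP uv|/eqP uv] := boolP (u == v).
  rewrite (single_orbit_double p_prime card_F N_prime zeta_prim N_ndvd_card
    a_neq0 uvE eE D_neq0 n_even uv) -/c.
  have D0 := disc_eq0.1 uv.
  (* Zero is also a square, so both alternatives of case (ii) are open here, matching the two orders
     allowed for u = v. *)
  have sqD : is_square (e ^+ 2 - 4%:R * a) by exists 0; rewrite D0 expr0n.
  have [o2|e2] := boolP (odd n./2); last first.
    by split=> [[cn|[]] //|[[]|[]] //]; left.
  split=> [[cn|[_ cn]]|[[]//|[_ _ [[]|[]]]]]; try by [left|right].
    by right; split=> //; right.
  by right; split=> //; left; split=> //; left.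
have Dn0 : e ^+ 2 - 4%:R * a <> 0 by move=> /disc_eq0.
have := frobenius_swap p_prime card_F 1 eE uvE; rewrite expn1.
case=> -[uq vq].
  rewrite (single_orbit_fixed p_prime card_F N_prime zeta_prim N_ndvd_card
    a_neq0 uvE eE D_neq0 uv uq vq) -/c.
  have sqD := disc_square.2 uq.
  have [o2|e2] := boolP (odd n./2); last first.
    by split=> [cn|[[]|[]] //]; left.
  split=> [cn|[[]//|[_ _ [[[]//]|[]]]]] //.
  by right; split=> //; right.
rewrite (single_orbit_swap p_prime card_F N_prime zeta_prim N_ndvd_card
  a_neq0 uvE eE D_neq0 uv uq vq) -/c opp.
have nsqD : ~ is_square (e ^+ 2 - 4%:R * a).
  by move=> /disc_square uq'; apply: uv; rewrite -uq'.
split=> [[[e2 cn]|[o2 cn]]|[[_ e2 cn]|[_ o2 [[_ cn]|[]]]]] //.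
- by left.
- by right; split=> //; left; split=> //; right.
- by left.
- by right.
Qed.

(** The square roots of beta_i^2 (e^2 - 4a) are beta_i (u - v) and its negative; the two signs
    belong to zeta^i and zeta^-i. *)
Lemma hroot_odd_char (b : K) : hroot b <->
  exists i : nat, (1 <= i <= n./2)%N /\
  exists r : K,
    r ^+ 2 = beta zeta i ^+ 2 * iota (e ^+ 2 - 4%:R * a) /\
    (b = - 2%:R^-1 * (iota e * (alpha zeta i - 2%:R) + r) \/
     b = - 2%:R^-1 * (iota e * (alpha zeta i - 2%:R) - r)).
Proof.
have zi0 i : zeta ^+ i != 0 by rewrite expf_neq0 // (prim_root_eq0 zeta_prim).
have ptE i : iota e - fiber_point u v (zeta ^+ i) =
    - 2%:R^-1 * (iota e * (alpha zeta i - 2%:R) + beta zeta i * (u - v)).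
  by rewrite -eE /fiber_point /alpha /beta; field; rewrite two_neq0 zi0.
have ptVE i : iota e - fiber_point u v (zeta ^- i) =
    - 2%:R^-1 * (iota e * (alpha zeta i - 2%:R) - beta zeta i * (u - v)).
  by rewrite -eE /fiber_point /alpha /beta invrK; field; rewrite two_neq0 zi0.
rewrite hroot_half; split=> -[i [ilt]].
  rewrite ptE ptVE => bE; exists i; split=> //.
  by exists (beta zeta i * (u - v)); rewrite exprMn sqr_uvB.
case=> r []; rewrite -sqr_uvB -exprMn => /eqP; rewrite eqf_sqr => /orP[] /eqP -> bE.
  by exists i; split=> //; rewrite ptE ptVE.
exists i; split=> //; rewrite ptE ptVE; move: bE; rewrite opprK.
by case; [right|left].
Qed.

End OddCharacteristic.

(** * Characteristic 2: traces of delta_i *)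

Section EvenCharacteristic.

Hypotheses (p_eq2 : p = 2%N) (e_neq0 : e != 0).

Let char2 : 2%N \in [pchar K].
Proof. by rewrite -p_eq2; apply: pchar_closure iota p_prime card_F. Qed.

Let uv_neq0 : u + v != 0.
Proof. by rewrite eE fmorph_eq0. Qed.

Let u_neq_v : u <> v.
Proof. by move=> uv; move/eqP: uv_neq0; rewrite uv addrr_pchar2. Qed.

Let card_pow (s : nat) : (#|F| ^ s)%N = (2 ^ (m * s))%N.
Proof. by rewrite card_F p_eq2 expnM. Qed.

Let zeta_neq0 (i : nat) : zeta ^+ i != 0.
Proof. by rewrite expf_neq0 // (prim_root_eq0 zeta_prim). Qed.

Let zeta1_neq0 (i : nat) : (0 < i < n.+1)%N -> 1 + zeta ^+ i != 0.
Proof.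
move=> /andP[i0 ltiN]; rewrite addr_eq0 oppr_pchar2 // eq_sym.
by rewrite -(prim_order_dvd zeta_prim) gtnNdvd.
Qed.

Local Notation P z := (artin_schreier_point u v z).

Lemma deltaE (i : nat) : (0 < i < n.+1)%N ->
  delta zeta (iota a) (iota e) i = P (zeta ^+ i) ^+ 2 + P (zeta ^+ i).
Proof.
move=> ilt; rewrite -delta_artin_schreier ?zeta1_neq0 //.
by rewrite /delta /alpha uvE eE.
Qed.

Lemma abs_trace2_delta (s i : nat) : (0 < i < n.+1)%N ->
  abs_trace2 (#|F| ^ s) (delta zeta (iota a) (iota e) i) =
  P (zeta ^+ i) ^+ (#|F| ^ s) + P (zeta ^+ i).
Proof.
by move=> ilt; rewrite deltaE // card_pow abs_trace2_artin_schreier.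
Qed.

Lemma frobenius_point (s : nat) (z : K) : P z ^+ (#|F| ^ s) =
  z ^+ (#|F| ^ s) / (1 + z ^+ (#|F| ^ s)) + u ^+ (#|F| ^ s) / (u + v).
Proof.
have F_D := frobeniusD iota p_prime card_F.
rewrite /artin_schreier_point F_D !exprMn !exprVn F_D expr1n.
by rewrite [in LHS]eE frobenius_iota -eE.
Qed.

Let v_over : v / (u + v) = u / (u + v) + 1.
Proof.
transitivity (u / (u + v) + 1 - 2%:R * (u / (u + v))); first by field.
by rewrite (two_eq0 char2) mul0r subr0.
Qed.

Lemma frobenius_zeta (k : nat) :
  zeta ^+ (#|F| ^ k) = Fp_expr zeta ((#|F|%:R : 'F_n.+1) ^+ k).
Proof. by rewrite -natrX (Fp_expr_nat N_prime zeta_prim). Qed.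

Lemma expr_swap (x y : K) (k : nat) : x ^+ #|F| = y -> y ^+ #|F| = x ->
  x ^+ (#|F| ^ k) = if odd k then y else x.
Proof.
move=> xy yx; elim: k => [|k IH]; first by rewrite expr1.
by rewrite expnSr exprM IH /=; case: (odd k).
Qed.

(** Apply the n/2-th power of Frobenius to P(zeta). It adds 1 if it inverts zeta, which happens for
    order n but not for order n/2, and 1 more if it swaps u and v, which requires a swap by
    Frobenius itself and odd n/2. The trace is 1 iff exactly one of these occurs, and this matches c
    = q or c = -q having order n. *)
Lemma single_orbit_char2 :
  (exists b, forall x, hroot x <-> exists k : nat, x = b ^+ (#|F| ^ k)) <->
  case_iii p #|F| n zeta (iota a) (iota e).
Proof.
rewrite /case_iii !order_mod_Fp //; set c := (#|F|%:R : 'F_n.+1).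
have c0 : c != 0 by apply: card_Fp_nat_neq0 N_ndvd_card.
have n0 : (0 < n)%N by lia.
have two0 : 2%:R != 0 :> 'F_n.+1.
  by rewrite -(dvdn_pcharf (pchar_Fp N_prime)) gtnNdvd.
have opp := primitive_root_oppf (card_Fp N_prime) n0 n_even two0 c0.
have lt1 : (0 < 1 < n.+1)%N by rewrite ltnS.
rewrite abs_trace2_delta // frobenius_point expr1.
have z0 := zeta_neq0 1; have z1 := zeta1_neq0 lt1; rewrite expr1 in z0 z1.
have PE : P zeta = zeta / (1 + zeta) + u / (u + v) by [].
have inv_over : zeta^-1 / (1 + zeta^-1) = zeta / (1 + zeta) + 1.
  transitivity (zeta / (1 + zeta) + 1 - 2%:R * (zeta / (1 + zeta))).
    by field; rewrite z1.
  by rewrite (two_eq0 char2) mul0r subr0.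
have zA : n.-primitive_root c -> zeta ^+ (#|F| ^ n./2) = zeta^-1.
  move=> cn; rewrite frobenius_zeta.
  rewrite (primitive_root_expr_half n_even cn) (Fp_exprN N_prime zeta_prim).
  by rewrite (Fp_expr_nat N_prime zeta_prim 1) expr1.
have zB : n./2.-primitive_root c -> zeta ^+ (#|F| ^ n./2) = zeta.
  move=> cn; rewrite frobenius_zeta (prim_expr_order cn).
  by rewrite (Fp_expr_nat N_prime zeta_prim 1) expr1.
have xx (x : K) : x + x = 0 by rewrite addrr_pchar2.
have n01 : 0 <> 1 :> K by apply/eqP; rewrite eq_sym oner_neq0.
have := frobenius_swap p_prime card_F 1 eE uvE; rewrite expn1.
case=> -[uq vq].
  rewrite (single_orbit_fixed p_prime card_F N_prime zeta_prim N_ndvd_card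
    a_neq0 uvE eE D_neq0 u_neq_v uq vq) -/c (expr_fixed_iter _ uq).
  split=> [cn|[_ [//|/zB ->]]]; last by rewrite -PE xx.
  split=> //; first by left.
  by rewrite zA // inv_over [X in X + _]addrAC -PE addrAC xx add0r.
rewrite (single_orbit_swap p_prime card_F N_prime zeta_prim N_ndvd_card
  a_neq0 uvE eE D_neq0 u_neq_v uq vq) -/c opp (expr_swap _ uq vq).
split=> [[[e2 cn]|[o2 cn]]|[_ [cn|cn]]].
- split=> //; first by left.
  by rewrite (negbTE e2) zA // inv_over [X in X + _]addrAC -PE addrAC xx add0r.
- split=> //; first by right.
  by rewrite o2 zB // v_over [X in X + _]addrA -PE addrAC xx add0r.
- rewrite zA // inv_over; case: ifP => [o2|e2 _].
    by rewrite v_over [X in X + _]addrACA -PE xx addr0 xx.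
  by left.
rewrite zB //; case: ifP => [o2 _|e2]; first by right.
by rewrite -PE xx.
Qed.

(** P(zeta^i) is fixed by the n-th power of Frobenius: zeta^i by Fermat, and u because n is even. So
    delta_i has absolute trace 0 over F_(q^n), and [as_root] is P or P + 1. The roots of h_g(-x) are
    alpha_i e times these solutions. *)
Lemma hroot_char2 (eps : K) : abs_trace2 (#|F| ^ n) eps = 1 ->
  forall x, hroot x <->
  exists i : nat, (1 <= i <= n./2)%N /\
    let b := as_root (#|F| ^ n) eps (delta zeta (iota a) (iota e) i) in
    x = alpha zeta i * iota e * b \/ x = alpha zeta i * iota e * (b + 1).
Proof.
move=> eps1 x; rewrite hroot_half.
have zfix (i : nat) : (zeta ^+ i) ^+ (#|F| ^ n) = zeta ^+ i.
  rewrite exprAC frobenius_zeta (expf_card_pred (card_Fp N_prime)).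
    by rewrite (Fp_expr_nat N_prime zeta_prim 1) expr1.
  exact: card_Fp_nat_neq0 N_ndvd_card.
have ufix : u ^+ (#|F| ^ n) = u.
  have := frobenius_swap p_prime card_F 1 eE uvE; rewrite expn1.
  case=> -[uq vq]; first exact: expr_fixed_iter.
  by rewrite (expr_swap _ uq vq) (negbTE n_even).
have Pfix i : P (zeta ^+ i) ^+ (#|F| ^ n) = P (zeta ^+ i).
  by rewrite frobenius_point zfix ufix.
have as_rootP i : (1 <= i <= n./2)%N ->
    let b := as_root (#|F| ^ n) eps (delta zeta (iota a) (iota e) i) in
    b = P (zeta ^+ i) \/ b = P (zeta ^+ i) + 1.
  move=> ilt b; have ilt' : (0 < i < n.+1)%N by lia.
  apply: artin_schreier_inj => //; rewrite /b -deltaE //.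
  have trd : abs_trace2 (#|F| ^ n) (delta zeta (iota a) (iota e) i) = 0.
    by rewrite abs_trace2_delta // Pfix addrr_pchar2.
  have dfix : delta zeta (iota a) (iota e) i ^+ (#|F| ^ n) =
      delta zeta (iota a) (iota e) i.
    by rewrite deltaE // (frobeniusD iota p_prime card_F) exprAC Pfix.
  move: eps1 trd dfix; rewrite card_pow => eps1 trd dfix.
  by rewrite as_root_artin_schreier // trd mulr0 add0r.
have pointE i : (1 <= i <= n./2)%N ->
    iota e - fiber_point u v (zeta ^+ i) =
      alpha zeta i * iota e * (P (zeta ^+ i) + 1) /\
    iota e - fiber_point u v (zeta ^- i) =
      alpha zeta i * iota e * P (zeta ^+ i).
  move=> ilt; have z1 : 1 + zeta ^+ i != 0 by apply: zeta1_neq0; lia.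
  by rewrite -eE fiber_point_artin_schreier1 // fiber_point_artin_schreier.
split=> -[i [ilt xE]]; exists i; split=> //; move: xE;
  have [-> ->] := pointE i ilt; have /= [->|->] := as_rootP i ilt.
- by case; [right|left].
- by rewrite -[_ + 1 + 1]addrA addrr_pchar2 // addr0.
- by case; [right|left].
- by rewrite -[_ + 1 + 1]addrA addrr_pchar2 // addr0.
Qed.

End EvenCharacteristic.
End Main.

Theorem proposition3p4
    (p m q n : nat) (F : finFieldType) (K : closedFieldType)
    (iota : {rmorphism F -> K}) (zeta : K) (a e : F)
    (hp : prime p) (hq : q = (p ^ m)%N) (hF : #|F| = q)
    (hn3 : (3 <= n.+1)%N) (hn : prime n.+1) (hnp : n.+1 <> p)
    (hnq : ~~ (n.+1 %| q ^ 2 - 1)%N)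
    (hzeta : n.+1.-primitive_root zeta)
    (ha : a != 0) (hD : ((dickson n.+1 a)^`()).[e] != 0)
    (* delta_i = 1 / alpha_i + a / e^2 has to be defined when p = 2 *)
    (he : p = 2%N -> e != 0) :
  let g := shifted_dickson n.+1 a e in
  let hroot := root (map_poly iota (h_poly g \Po (- 'X))) in
  [/\ good iota g <->
        [\/ case_i p q n, case_ii p q n a e
          | case_iii p q n zeta (iota a) (iota e)],
      case_i p q n \/ case_ii p q n a e ->
        forall b : K,
          hroot b <->
          exists i : nat, (1 <= i <= n./2)%N /\
          exists r : K,
            r ^+ 2 = beta zeta i ^+ 2 * iota (e ^+ 2 - 4%:R * a) /\
            (b = - 2%:R^-1 * (iota e * (alpha zeta i - 2%:R) + r) \/
             b = - 2%:R^-1 * (iota e * (alpha zeta i - 2%:R) - r))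
    & case_iii p q n zeta (iota a) (iota e) ->
        forall eps : K, in_Fq q n eps -> abs_trace2 (q ^ n) eps = 1 ->
        forall x : K,
          hroot x <->
          exists i : nat, (1 <= i <= n./2)%N /\
            let b := as_root (q ^ n) eps (delta zeta (iota a) (iota e) i) in
            x = alpha zeta i * iota e * b \/
            x = alpha zeta i * iota e * (b + 1)].
Proof.
case: q / hF hq hnq => cF hnq g hroot; rewrite ltnS in hn3.
have [u [v [eE uvE]]] := closed_field_sum_prod (iota e) (iota a).
have goodP := good_single_orbit iota hp cF hn hnp ha hD hnq.
split.
- rewrite goodP; have [/eqP p2|/eqP p2] := boolP (p == 2%N).
    rewrite (single_orbit_char2 hp cF hn3 hn hzeta hnp ha uvE eE hD p2 (he p2)).
    by split=> [|[[]|[]|]] //; [apply: Or33].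
  rewrite (single_orbit_odd_char hp cF hn3 hn hzeta hnp ha uvE eE hD p2).
  by split=> [[]|[||[]]]; [apply: Or31|apply: Or32|left|right|].
- move=> case12; have p2 : p <> 2%N by case: case12 => -[].
  exact: (hroot_odd_char hp cF hn3 hn hzeta hnp ha uvE eE hD p2).
- move=> [p2 _ _] eps _ eps1.
  exact: (hroot_char2 hp cF hn3 hn hzeta hnp ha uvE eE hD p2 (he p2) eps1).
Qed.
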